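(* For every $n\ge 0$, the set $\mathcal{A}_{2n}$ of alternating faro permutations of length $2n$ is exactly the set of faro derangements of length $2n$, i.e. faro permutations $w$ of length $2n$ with $w_i\ne i$ for all $i\in\{1,\dots,2n\}$.
   Context: A faro permutation of length $m$ is a permutation $w=w_1\cdots w_m$ of $\{1,\dots,m\}$ obtained by interlacing two increasing words $u,v$ as $u_1v_1u_2v_2\cdots$ with $0\le|u|-|v|\le1$ (equivalently, $w_i<w_{i+2}$ for all $1\le i\le m-2$). It is alternating if $w_1>w_2<w_3>w_4<\cdots$. *)

(* Defs.v *)
From mathcomp Require Import all_boot all_fingroup.
From mathcomp Require Import boolp classical_sets.

Set Implicit Arguments.
Unset Strict Implicit.
Unset Printing Implicit Defensive.

Local Open Scope classical_set_scope.

(* A permutation of {1, ..., m} is an element w of 'S_m, with positions and   *)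
(* values both shifted down by one; its one-line word is codom w. Position i  *)
(* of the literature is position i - 1 here, so parities are exchanged.       *)

(* u_1 v_1 u_2 v_2 ... ; once one word is exhausted, the rest of the other    *)
(* one is appended.                                                           *)
Fixpoint interlace (T : Type) (u v : seq T) : seq T :=
  match u, v with
  | a :: u', b :: v' => a :: b :: interlace u' v'
  | [::], _ => v
  | _, [::] => u
  end.

Definition increasing (m : nat) (u : seq 'I_m) : bool :=
  sorted (fun a b : 'I_m => a < b) u.

Definition faro (m : nat) (w : 'S_m) : Prop :=
  exists u v : seq 'I_m,
    [/\ increasing u, increasing v, size v <= size u <= (size v).+1
      & codom w = interlace u v].

Definition alternating (m : nat) (w : 'S_m) : Prop :=
  forall i j : 'I_m, j = i.+1 :> nat ->
    if odd i then w i < w j else w j < w i.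

Definition derangement (m : nat) (w : 'S_m) : Prop :=
  forall i : 'I_m, w i <> i.

Definition alternating_faro (m : nat) : set 'S_m :=
  [set w | faro w /\ alternating w].
Arguments alternating_faro m : clear implicits.

Definition faro_derangements (m : nat) : set 'S_m :=
  [set w | faro w /\ derangement w].
Arguments faro_derangements m : clear implicits.

(* Main.v *)
Require Import Defs.
From mathcomp Require Import all_boot all_fingroup.
From mathcomp Require Import boolp classical_sets.
From mathcomp Require Import zify.

(** The value of a permutation [w] at [i] is the number of positions carrying
    a smaller value ([perm_rank]), so [i] is a fixed point as soon as the
    positions with values below [w i] are exactly the positions before [i].
    In a faro permutation the letters at even positions (counted from 0)
    increase, and so do those at odd positions ([faro_parity_increasing]).
    Hence alternation only has to be tested on the pairs (2k, 2k+1), where it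
    asks for a descent: a descent at each such pair gives
    w (2k+1) < w (2k) < w (2k+2), the required ascents
    ([alternating_pair_descents]).

    If all these pairs are descents, an even position i has smaller values at
    all earlier positions and also at i + 1, so w i > i; an odd position i can
    have smaller values only at earlier positions, and not at i - 1, so
    w i < i.  There is thus no fixed point; the even length is what provides
    the position i + 1 when i is even.

    Conversely, let (i, i + 1) be the first pair that is not a descent.  The
    descents before it bound the earlier odd-position letters by earlier
    even-position letters, so everything before i is smaller than w i, while
    w i < w (i + 1) makes everything after i larger.  So w i = i
    ([first_pair_ascent_fixed]), which a derangement forbids. *)

Lemma card_ord_below (m : nat) (i : 'I_m) : #|[set j : 'I_m | j < i]| = i.
Proof.
rewrite cardsE -sum1_card -(big_ord_widen _ (fun=> 1)) 1?ltnW //.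
by rewrite sum1_card card_ord.
Qed.

Lemma perm_rank {m : nat} (w : 'S_m) (i : 'I_m) :
  #|[set j | w j < w i]| = w i.
Proof.
rewrite -[RHS]card_ord_below -[RHS](card_preimset _ (@perm_inj _ w)).
by apply: eq_card => j; rewrite !inE.
Qed.

Lemma nth_interlace (T : Type) (x : T) (u v : seq T) (i : nat) :
  size v <= size u <= (size v).+1 ->
  nth x (interlace u v) i = nth x (if odd i then v else u) i./2.
Proof.
elim: u v i => [|a u IHu] [|b v] i //=.
- by rewrite if_same !nth_nil.
- (* Here [v] is exhausted, so [u] holds a single letter. *)
  case: u {IHu} => // _.
  by case: i => [|[|i]] //=; rewrite negbK; case: (odd i); rewrite /= ?nth_nil.
- by case: i => [|[|i]] //= size_uv; rewrite IHu // negbK; case: (odd i).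
Qed.

Definition parity_increasing {m : nat} (w : 'S_m) : Prop :=
  forall i j : 'I_m, i < j -> odd i = odd j -> w i < w j.

Definition pair_descents {m : nat} (w : 'S_m) : Prop :=
  forall i j : 'I_m, ~~ odd i -> j = i.+1 :> nat -> w j < w i.

Lemma size_interlace (T : Type) (u v : seq T) :
  size (interlace u v) = size u + size v.
Proof. by elim: u v => [|a u IHu] [|b v] //=; rewrite ?addn0 // IHu addnS. Qed.

Lemma faro_parity_increasing {m : nat} (w : 'S_m) :
  faro w -> parity_increasing w.
Proof.
move=> [u [v [inc_u inc_v size_uv word_w]]] i j lt_ij odd_ij.
have nthw (k : 'I_m) : w k = nth i (if odd k then v else u) k./2.
  by rewrite -nth_interlace // -word_w codomE (nth_map i) ?size_enum_ord // nth_ord_enum.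
have size_w : size u + size v = m.
  by rewrite -size_interlace -word_w size_codom card_ord.
have lt_trans : transitive (fun a b : 'I_m => a < b).
  by move=> a b c; apply: ltn_trans.
have lt_half : i./2 < j./2 by lia.
have ltim := ltn_ord i; have ltjm := ltn_ord j.
rewrite !nthw odd_ij.
case: ifP => odd_j.
  by apply: (sorted_ltn_nth lt_trans i inc_v) => //; rewrite inE; lia.
by apply: (sorted_ltn_nth lt_trans i inc_u) => //; rewrite inE; lia.
Qed.

Lemma alternating_pair_descents {m : nat} (w : 'S_m) :
  parity_increasing w -> alternating w <-> pair_descents w.
Proof.
move=> incw; split=> [alt_w i j even_i ji|desc_w i j ji].
  by have := alt_w i j ji; rewrite (negPf even_i).
case: ifP => odd_i; last by apply: desc_w => //; rewrite odd_i.
have lt_pred : i.-1 < m by have := ltn_ord i; lia.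
apply: (@ltn_trans (w (Ordinal lt_pred))).
  by apply: desc_w => /=; lia.
by apply: incw => /=; lia.
Qed.

Lemma pair_descents_derangement {m : nat} (w : 'S_m) :
  ~~ odd m -> parity_increasing w -> pair_descents w -> derangement w.
Proof.
move=> even_m incw desc_w i fix_i.
suff: [set j : 'I_m | j < i] \proper [set j | w j < w i]
      \/ [set j | w j < w i] \proper [set j : 'I_m | j < i].
  by case=> /proper_card; rewrite perm_rank card_ord_below fix_i ltnn.
have ltim := ltn_ord i.
case: (boolP (odd i)) => odd_i; [right | left].
  have lt_pred : i.-1 < m by lia.
  have desc_i : w i < w (Ordinal lt_pred) by apply: desc_w => /=; lia.
  apply/properP; split.
    apply/fintype.subsetP => j; rewrite !inE => lt_w.
    case: (ltngtP j i) => // [lt_ij|/val_inj eq_ij]; last first.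
      by rewrite eq_ij ltnn in lt_w.
    case: (boolP (odd j)) => odd_j.
      by have := incw i j lt_ij ltac:(lia); lia.
    (* A later even position is compared with [i] through [i - 1]. *)
    by have := incw (Ordinal lt_pred) j ltac:(simpl; lia) ltac:(simpl; lia); lia.
  by exists (Ordinal lt_pred); rewrite inE /=; lia.
have lt_succ : i.+1 < m by lia.
have desc_i : w (Ordinal lt_succ) < w i by apply: desc_w.
apply/properP; split.
  apply/fintype.subsetP => j; rewrite !inE => lt_ji.
  case: (boolP (odd j)) => odd_j; last by apply: incw => //; lia.
  (* An earlier odd position is compared with [i] through [i + 1]. *)
  by have := incw j (Ordinal lt_succ) ltac:(simpl; lia) ltac:(simpl; lia); lia.
by exists (Ordinal lt_succ); rewrite inE /=; lia.
Qed.

(** No letter before such a pair can exceed [w i] and none after it can be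
    smaller, so the rank of [w i] is [i] itself. *)
Lemma first_pair_ascent_fixed {m : nat} (w : 'S_m) (i j : 'I_m) :
  parity_increasing w -> ~~ odd i -> j = i.+1 :> nat -> w i < w j ->
  (forall k l : 'I_m, k < i -> ~~ odd k -> l = k.+1 :> nat -> w l < w k) ->
  w i = i.
Proof.
move=> incw even_i ji asc_i desc_before; apply: val_inj.
rewrite /= -perm_rank -[RHS]card_ord_below; apply: eq_card => k; rewrite !inE.
case: (ltngtP k i) => [lt_ki|lt_ik|/val_inj ->]; last by rewrite ltnn.
  case: (boolP (odd k)) => odd_k; last by apply: incw => //; lia.
  have lt_pred : k.-1 < m by have := ltn_ord k; lia.
  apply: (@ltn_trans (w (Ordinal lt_pred))).
    by apply: desc_before => /=; lia.
  by apply: incw => /=; lia.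
apply/negbTE; rewrite -leqNgt.
case: (boolP (odd k)) => odd_k; last by apply/ltnW/incw => //; lia.
case: (ltngtP k j) => [|lt_jk|/val_inj ->]; [by lia | | exact: ltnW].
by have := incw j k lt_jk ltac:(lia); lia.
Qed.

Lemma derangement_pair_descents {m : nat} (w : 'S_m) :
  parity_increasing w -> derangement w -> pair_descents w.
Proof.
move=> incw der_w i.
have [b le_ib] := ubnP (val i); elim: b i le_ib => // b IHb i le_ib j even_i ji.
case: (ltngtP (w j) (w i)) => // [asc_i|/val_inj/perm_inj eq_ij]; last first.
  by rewrite eq_ij in ji; lia.
case: (der_w i); apply: (first_pair_ascent_fixed _ i j) => // k l lt_ki.
exact/IHb/(leq_trans lt_ki).
Qed.

Theorem theorem4p5 (n : nat) :
  alternating_faro (2 * n) = faro_derangements (2 * n).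
Proof.
apply/seteqP; split=> w [faro_w Pw]; split=> //;
  have incw := faro_parity_increasing _ faro_w.
  apply: pair_descents_derangement => //; first by rewrite oddM.
  exact/alternating_pair_descents.
exact/(alternating_pair_descents _ incw)/derangement_pair_descents.
Qed.
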